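(* Of the functions $\{S_\lambda\}_{\lambda\vdash n\ge1}$ in $\mathrm{NCSym}$ and their scalar multiples, only the functions $S_{(1^n)}$ ($n\geq 1$) can be realized as $Y_G$ for some graph $G$. That is, if $n\ge1$, $\lambda\vdash n$, $c\in\mathbb{Q}$ and $cS_\lambda=Y_G$ for some labelled graph $G$, then $\lambda=(1^n)$ and $c=1$; and in particular $$S_{(1^n)}=Y_{K_n}\quad\text{for all } n\ge1.$$
   Context: All graphs are finite, simple and labelled: a graph $G$ with $n$ vertices has its vertices labelled bijectively by $[n]=\{1,\dots,n\}$; write $v_i$ for the vertex labelled $i$. $K_n$ is the complete graph on $n$ vertices. Let $x_1,x_2,\dots$ be noncommuting variables. A proper colouring of $G$ is a map $\kappa$ from the vertices to $\{1,2,\dots\}$ with $\kappa(u)\ne\kappa(v)$ whenever $u,v$ are adjacent. $Y_G=\sum_\kappa x_{\kappa(v_1)}\cdots x_{\kappa(v_n)}\in\mathbb{Q}\langle\langle x_1,x_2,\dots\rangle\rangle$, summed over all proper colourings $\kappa$ of $G$. $\mathrm{NCSym}\subset\mathbb{Q}\langle\langle x_1,x_2,\dots\rangle\rangle$ is the algebra of symmetric functions in noncommuting variables, spanned by $1$ and the functions $m_\pi=\sum x_{i_1}\cdots x_{i_n}$ ($\pi$ a set partition of $[n]$, $n\ge1$; sum over tuples of positive integers with $i_j=i_k$ if and only if $j,k$ are in the same block of $\pi$). For an integer partition $\lambda\vdash n$, the Rosas–Sagan Schur-like function $S_\lambda\in\mathrm{NCSym}$ is $$S_\lambda=\sum_{(T,\beta)}x_{T(\beta^{-1}(1))}\,x_{T(\beta^{-1}(2))}\cdots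 x_{T(\beta^{-1}(n))},$$ summed over all pairs $(T,\beta)$ where $T$ is a semistandard Young tableau of shape $\lambda$ with positive integer entries (rows weakly increasing, columns strictly increasing) and $\beta$ is a bijection from the cells of $\lambda$ to $[n]$; here $T(c)$ is the entry of $T$ in cell $c$. $(1^n)$ denotes the integer partition of $n$ with $n$ parts equal to $1$. *)

(* Defs.v *)
From mathcomp Require Import all_boot all_order all_algebra.
From mathcomp Require Import boolp classical_sets functions cardinality fsbigop.

Set Implicit Arguments.
Unset Strict Implicit.
Unset Printing Implicit Defensive.
Import GRing.Theory.
Local Open Scope ring_scope.

(** Indices are shifted by one throughout: [i : nat] stands for the positive
    integer [i.+1] (as a colour, a tableau entry, or the index of the variable
    [x_(i.+1)]), and ['I_n] for the set {1, ..., n}. *)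

(** Q<<x_1, x_2, ...>>: a series is the function giving the coefficient of each
    word in the variables. *)
Definition ncseries := seq nat -> rat^o.

Definition monomial (w : seq nat) : ncseries := fun u => (u == w)%:R.

(** Formal sum of the monomials [word i], for [i] in [A], taken coefficientwise.
    The finitely supported sum on the right is the intended one as soon as each
    word is [word i] for finitely many [i] in [A]; this is the case in all uses
    below. *)
Definition monomial_sum (I : choiceType) (A : set I) (word : I -> seq nat) :
    ncseries :=
  fun u => \sum_(i \in A) monomial (word i) u.

(** A labelled graph on n vertices; the vertex [v_i] is identified with its
    label. *)
Record lgraph (n : nat) := LGraph {
  adj :> rel 'I_n;
  adj_sym : symmetric adj;
  adj_irrefl : irreflexive adj }.

Section Complete.
Variable n : nat.

Definition complete_adj : rel 'I_n := fun u v => u != v.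

Lemma complete_adj_sym : symmetric complete_adj.
Proof. by move=> u v; rewrite /complete_adj eq_sym. Qed.

Lemma complete_adj_irrefl : irreflexive complete_adj.
Proof. by move=> u; rewrite /complete_adj eqxx. Qed.

Definition complete_graph : lgraph n :=
  LGraph complete_adj_sym complete_adj_irrefl.

End Complete.

Definition proper_colouring n (G : lgraph n) (kappa : {ffun 'I_n -> nat}) :=
  forall u v : 'I_n, G u v -> kappa u <> kappa v.

Definition Y n (G : lgraph n) : ncseries :=
  monomial_sum [set kappa | proper_colouring G kappa]%classic
    (fun kappa : {ffun 'I_n -> nat} => [seq kappa v | v <- enum 'I_n]).

Definition is_partition (n : nat) (la : seq nat) : bool :=
  [&& sorted geq la, all (leq 1) la & sumn la == n].

(** The cells of the diagram of [la]: a row index, and a column index which is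
    smaller than the length of that row. *)
Definition cell (la : seq nat) := {r : 'I_(size la) & 'I_(nth 0%N la r)}.

Definition row_of la (x : cell la) : nat := tag x.
Definition col_of la (x : cell la) : nat := tagged x.

Definition semistandard la (T : {ffun cell la -> nat}) : Prop :=
  (forall x y : cell la,
     row_of x = row_of y -> (col_of x <= col_of y)%N -> (T x <= T y)%N) /\
  (forall x y : cell la,
     col_of x = col_of y -> (row_of x < row_of y)%N -> (T x < T y)%N).

(** The [j]-th letter is [T (beta^-1 j)]. The default letter 0 is never used
    when [beta] is bijective. *)
Definition tableau_word la (T : {ffun cell la -> nat})
    (beta : {ffun cell la -> 'I_(sumn la)}) : seq nat :=
  [seq oapp T 0%N [pick x | beta x == j] | j <- enum 'I_(sumn la)].

Definition S_ (la : seq nat) : ncseries :=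
  monomial_sum
    [set Tb : {ffun cell la -> nat} * {ffun cell la -> 'I_(sumn la)} |
       semistandard Tb.1 /\ bijective Tb.2]%classic
    (fun Tb => tableau_word Tb.1 Tb.2).

(* Main.v *)
(** The coefficient of a word [u] in [S_ la] is the number of bijections [beta]
    from the cells to the positions for which [u o beta] is semistandard, while
    in [Y G] it is 1 or 0 according to whether [u] is a proper colouring.
    Suppose [c S_la = Y_G] and some row of [la] contains two cells. Filling each
    row with its own letter, and placing the two cells at any two positions [i]
    and [j], gives a word of nonzero coefficient in which these positions carry
    the same letter: so [ij] is not an edge, and [G] is edgeless. Hence the
    constant word and the word with all letters distinct have the same
    coefficient. But once one bijection is admissible for the constant word, all
    are, whereas for the word with distinct letters exchanging the values on two
    cells of one row is not allowed.
    For a single column, [u o beta] is semistandard if and only if it increases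
    down the column: one [beta] does this if the letters of [u] are distinct, and
    none otherwise. *)
Require Import Defs.
From mathcomp Require Import all_boot all_order all_fingroup all_algebra.
From mathcomp Require Import boolp classical_sets functions cardinality fsbigop.
Import GRing.Theory Num.Theory.
Local Open Scope ring_scope.

Set Implicit Arguments.
Unset Strict Implicit.

(** * Coefficients of [Y] and [S_] as counts *)

Lemma monomial_sum_coef (I : choiceType) (A : set I) (word : I -> seq nat)
    (u : seq nat) (s : seq I) :
  uniq s -> (forall i, i \in s <-> A i /\ word i = u) ->
  monomial_sum A word u = (size s)%:R.
Proof.
move=> s_uniq s_mem.
have in_s i : i \in s -> A i /\ word i = u by move=> /(s_mem i).1.
(* Indices outside [s] contribute 0 to the coefficient of [u], so the sum is an ordinary one over
   [s], with all terms 1. *)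
rewrite /monomial_sum (fsbigE s) //; first last.
- move=> i Ai si; rewrite /monomial; case: eqP => // ui.
  by rewrite (s_mem i).2 in si.
- by move=> i /in_s[].
rewrite big_seq_cond (eq_bigr (fun=> 1)) => [|i /andP[/in_s[_ wi] _]]; last first.
  by rewrite /monomial wi eqxx.
rewrite (eq_bigl (mem s)) => [|i /=].
  by rewrite -big_seq big_const_seq count_predT iter_addr_0.
by case: (boolP (i \in s)) => //= /in_s[Ai _]; exact/mem_set.
Qed.

Definition letter {n} (u : seq nat) : {ffun 'I_n -> nat} :=
  [ffun i : 'I_n => nth 0%N u i].

Lemma word_eqP n (f : 'I_n -> nat) (u : seq nat) :
  [seq f i | i <- enum 'I_n] = u <->
  size u = n /\ forall i : 'I_n, f i = letter u i.
Proof.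
split=> [<-|[su fu]].
  split=> [|i]; first by rewrite size_map size_enum_ord.
  by rewrite ffunE (nth_map i) ?size_enum_ord // nth_ord_enum.
apply: (@eq_from_nth _ 0%N) => [|i]; rewrite size_map size_enum_ord // => lt_in.
by rewrite (nth_map (Ordinal lt_in)) ?size_enum_ord // fu ffunE nth_enum_ord.
Qed.

Lemma Y_coef n (G : lgraph n) (u : seq nat) :
  Y G u = ((size u == n) && `[< proper_colouring G (letter u) >])%:R.
Proof.
case: (boolP (_ && _)) => [/andP[/eqP su /asboolP Gu]|Gu].
- rewrite /Y (@monomial_sum_coef _ _ _ _ [:: letter u]) // => kappa.
  rewrite inE; split=> [/eqP->|[/= _ /word_eqP[_ ku]]].
    by split=> //; apply/word_eqP.
  by apply/eqP/ffunP.
- rewrite /Y (@monomial_sum_coef _ _ _ _ [::]) // => kappa.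
  split=> // -[/= Gk /word_eqP[su ku]].
  case/negP: Gu; rewrite su eqxx; apply/asboolP.
  by move/ffunP: ku => <-.
Qed.

(** Distinct letters are a proper colouring of every graph; this word will normalise [c]. *)
Lemma Y_iota n (G : lgraph n) : Y G (iota 0 n) = 1.
Proof.
rewrite Y_coef size_iota eqxx; case: asboolP => // -[] u v Guv.
rewrite !ffunE !nth_iota // !add0n => /val_inj uv.
by move: Guv; rewrite uv (adj_irrefl G).
Qed.

Lemma card_cell la : #|{: cell la}| = sumn la.
Proof.
rewrite card_tagged !sumnE big_map big_enum [RHS](big_nth 0%N) big_mkord.
by apply: eq_bigr => i _; rewrite card_ord.
Qed.

(** For bijective [beta] each [pick] finds exactly one cell, so the default letter never occurs and
    [T] is [u] read through [beta]. *)
Lemma tableau_wordP la (T : {ffun cell la -> nat})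
    (beta : {ffun cell la -> 'I_(sumn la)}) (u : seq nat) : bijective beta ->
  tableau_word T beta = u <->
  size u = sumn la /\ T = [ffun x => letter u (beta x)].
Proof.
move=> beta_bij; have beta_inj := bij_inj beta_bij.
have pickE x : [pick y | beta y == beta x] = Some x.
  case: pickP => [y /eqP/beta_inj-> //|/(_ x)]; by rewrite eqxx.
rewrite /tableau_word word_eqP; split=> -[su Tu]; split=> //.
  by apply/ffunP => x; rewrite ffunE -Tu pickE.
case: beta_bij => g betaK gK j.
by rewrite -(gK j) pickE /= Tu ffunE.
Qed.

(* The word [u] together with [beta] determines the tableau, so the coefficient
   of [u] in [S_ la] counts these labellings. *)
Definition labellings la (u : seq nat) : {set {ffun cell la -> 'I_(sumn la)}} :=
  [set beta : {ffun cell la -> 'I_(sumn la)} |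
     `[< bijective beta /\ semistandard [ffun x => letter u (beta x)] >]].

Lemma labellingsP la u (beta : {ffun cell la -> 'I_(sumn la)}) :
  reflect (bijective beta /\ semistandard [ffun x => letter u (beta x)])
          (beta \in labellings la u).
Proof. by rewrite inE; apply: asboolP. Qed.

Lemma S_coef la (u : seq nat) : size u = sumn la ->
  S_ la u = #|labellings la u|%:R.
Proof.
move=> su; pose h (beta : {ffun cell la -> 'I_(sumn la)}) :=
  ([ffun x => letter u (beta x)] : {ffun cell la -> nat}, beta).
rewrite /S_ (@monomial_sum_coef _ _ _ _ [seq h b | b <- enum (labellings la u)]).
- by rewrite size_map -cardE.
- by rewrite map_inj_uniq ?enum_uniq // => b b' [].
- case=> T beta; split=> [/mapP[b]|[[/= ssT bij] /tableau_wordP]].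
    rewrite mem_enum => /labellingsP[bij ss] [-> ->].
    by split; [split|apply/tableau_wordP].
  case=> // _ TE; apply/mapP; exists beta; last by rewrite /h TE.
  by rewrite mem_enum; apply/labellingsP; rewrite -TE.
Qed.

Lemma S_coef_size la u : size u != sumn la -> S_ la u = 0.
Proof.
move=> su; rewrite /S_ (@monomial_sum_coef _ _ _ _ [::]) // => -[T beta].
by split=> // -[[_ bij] /tableau_wordP[] // suE]; rewrite suE eqxx in su.
Qed.

(** * Bijections with prescribed values, and row fillings *)

Lemma exists_bij (A B : finType) : #|A| = #|B| ->
  exists f : {ffun A -> B}, bijective f.
Proof.
move=> AB; exists [ffun x => enum_val (cast_ord AB (enum_rank x))].
exists (fun y => enum_val (cast_ord (esym AB) (enum_rank y))) => x;
  by rewrite ffunE enum_valK (cast_ordK, cast_ordKV) enum_rankK.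
Qed.

(** Any bijection is corrected by two transpositions of the target: [p] brings the image of [x] to
    [i], then [q] brings that of [y] to [j] and leaves [i] fixed. *)
Lemma exists_bij2 (A B : finType) (x y : A) (i j : B) : #|A| = #|B| ->
  x != y -> i != j ->
  exists f : {ffun A -> B}, [/\ bijective f, f x = i & f y = j].
Proof.
move=> /exists_bij[f f_bij] xy ij.
pose p := tperm (f x) i; pose q := tperm (p (f y)) j.
have pfy : p (f y) != i.
  by rewrite -(tpermL (f x) i) (inj_eq perm_inj) (inj_eq (bij_inj f_bij)) eq_sym.
exists [ffun z => q (p (f z))]; split; rewrite ?ffunE.
- apply: (@eq_bij _ _ (q \o p \o f)) => [|z]; last by rewrite ffunE.
  by apply: bij_comp f_bij; apply: bij_comp; apply/injF_bij/perm_inj.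
- by rewrite tpermL tpermD // eq_sym.
- by rewrite tpermL.
Qed.

(* Filling row [r] with the letter [r] gives a semistandard tableau. *)
Lemma exists_row_word la (beta : {ffun cell la -> 'I_(sumn la)}) :
  bijective beta ->
  exists2 u, size u = sumn la &
    beta \in labellings la u /\ forall x, letter u (beta x) = row_of x.
Proof.
move=> bij; pose T : {ffun cell la -> nat} := [ffun x => row_of x].
have [su TE] : size (tableau_word T beta) = sumn la /\
    T = [ffun x => letter (tableau_word T beta) (beta x)] by apply/tableau_wordP.
have rowE x : letter (tableau_word T beta) (beta x) = row_of x.
  by move/ffunP/(_ x): TE; rewrite !ffunE => <-.
exists (tableau_word T beta) => //; split=> //.
apply/labellingsP; split=> //; rewrite -TE.
by split=> x y; rewrite !ffunE => // ->.
Qed.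

(** * Ranks in a finite set *)

Definition rank (T : finType) (f : T -> nat) (x : T) : nat :=
  #|[set y | f y < f x]%N|.

Lemma rank_lt (T : finType) (f : T -> nat) (x y : T) :
  (rank f x < rank f y)%N = (f x < f y)%N.
Proof.
have mono v w : (f v <= f w)%N -> (rank f v <= rank f w)%N.
  move=> vw; apply/subset_leq_card/fintype.subsetP => z; rewrite !inE => zv.
  exact: leq_trans zv vw.
apply/idP/idP => [|xy]; first by apply: contraLR; rewrite -!leqNgt; apply: mono.
apply/proper_card/fintype.properP; split; last by exists x; rewrite !inE ?ltnn.
by apply/fintype.subsetP => z; rewrite !inE => /ltn_trans; apply.
Qed.

Lemma rank_lt_card (T : finType) (f : T -> nat) (x : T) : (rank f x < #|T|)%N.
Proof.
apply/proper_card/fintype.properP.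
by split; [apply/fintype.subsetP|exists x; rewrite ?inE ?ltnn].
Qed.

Lemma rank_inj (T : finType) (f : T -> nat) : injective f -> injective (rank f).
Proof.
move=> f_inj x y xy; apply: f_inj; have := rank_lt f x y; have := rank_lt f y x.
by rewrite xy ltnn; case: ltngtP.
Qed.

(** The image under [b] of the elements below [x] is the set of elements below [b x]: as [r] is
    injective, the one-way monotonicity is an equivalence. *)
Lemma rank_bij (S T : finType) (b : S -> T) (r : S -> nat) (f : T -> nat) :
  bijective b -> injective r ->
  (forall y z, r y < r z -> f (b y) < f (b z))%N ->
  forall x, rank f (b x) = rank r x.
Proof.
move=> b_bij r_inj mono x; have b_inj := bij_inj b_bij.
rewrite /rank -[RHS](card_imset _ b_inj).
have [g bK gK] := b_bij; apply: eq_card => j.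
rewrite -(gK j) inE mem_imset // inE; apply/idP/idP; last exact: mono.
apply: contraLR; rewrite -!leqNgt leq_eqVlt => /orP[/eqP/r_inj-> //|/mono].
exact: ltnW.
Qed.

Lemma rank_ord (T : finType) n (r : T -> 'I_n) : bijective r ->
  rank (fun x => r x : nat) =1 r.
Proof.
move=> r_bij x; have [g rK gK] := r_bij.
rewrite /rank -sum1dep_card (reindex g); last by exists r => y _.
under eq_bigl => i do rewrite gK.
by rewrite (big_ord_narrow (ltnW (ltn_ord (r x)))) sum1_card card_ord.
Qed.

(** * Single columns and complete graphs *)

Lemma S_column_eq_Y_complete la : all (pred1 1%N) la ->
  S_ la = Y (complete_graph (sumn la)).
Proof.
move=> la1; have nth1 (i : 'I_(size la)) : nth 0%N la i = 1%N.
  exact/eqP/(all_nthP 0%N la1).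
have size_la : size la = sumn la.
  by rewrite [in RHS](all_pred1P _ _ la1) sumn_nseq mul1n.
have col0 (x : cell la) : col_of x = 0%N.
  apply/eqP; rewrite -leqn0 -ltnS -(nth1 (tag x)); exact: ltn_ord (tagged x).
have row_inj : injective (@row_of la).
  move=> [i a] [j b]; rewrite /row_of /= => /val_inj ij.
  case: j / ij b => b; congr existT; apply: val_inj.
  exact: etrans (col0 (existT _ i a)) (esym (col0 (existT _ i b))).
have row_lt (x : cell la) : (row_of x < sumn la)%N.
  by rewrite -size_la; apply: ltn_ord (tag x).
pose row x := Ordinal (row_lt x).
have row_bij : bijective row.
  apply: inj_card_bij; last by rewrite card_cell card_ord.
  by move=> x y /(congr1 val)/row_inj.
have ssE (f : cell la -> nat) : semistandard [ffun x => f x] <->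
    forall x y, (row_of x < row_of y)%N -> (f x < f y)%N.
  split=> [[_ ss] x y xy|ss].
    by have := ss x y; rewrite !ffunE !col0; apply.
  by split=> [x y /row_inj->|x y _ /ss]; rewrite !ffunE.
apply: funext => u; rewrite Y_coef.
have [su|su] := eqVneq (size u) (sumn la); last by rewrite S_coef_size.
rewrite S_coef //=; case: asboolP => [u_proper|u_improper]; last first.
  rewrite (_ : labellings la u = finset.set0) ?cards0 //; apply/setP => beta.
  rewrite [in RHS]inE; apply/negP => /labellingsP[[g bK gK] /ssE ss].
  (* Two positions with equal letters would lie in different rows of the column, against strict
     increase. *)
  apply: u_improper => i j /= ij uij.
  have := ss (g i) (g j); have := ss (g j) (g i); rewrite !gK uij ltnn.
  case: (ltngtP (row_of (g i)) (row_of (g j))) => [_ _|_|]; try by move/(_ isT).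
  move=> /row_inj gij; case/eqP: ij; exact: (can_inj gK).
have u_inj : injective (@letter (sumn la) u).
  move=> i j; apply: contra_eq => /u_proper ij; exact/eqP.
have row_rank : rank (@row_of la) =1 row by apply: (rank_ord row_bij).
pose urank j : 'I_(sumn la) :=
  Ordinal (leq_trans (rank_lt_card (letter u) j) (eq_leq (card_ord _))).
have urank_inj : injective urank.
  by move=> i j /(congr1 val) /(rank_inj u_inj).
have [urankV urankK urankVK] := injF_bij urank_inj.
(* The only candidate: the cell in row [r] goes to the position whose letter has rank [r]. *)
pose beta0 : {ffun cell la -> 'I_(sumn la)} := [ffun x => urankV (row x)].
rewrite (_ : labellings la u = finset.set1 beta0) ?cards1 //.
apply/setP => beta; rewrite [in RHS]inE.
apply/labellingsP/eqP => [[beta_bij /ssE ss]|->].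
  (* An admissible [beta] preserves order, hence rank, and the rank of a cell is its row. *)
  apply/ffunP => x; rewrite ffunE; apply: (canRL urankK); apply: val_inj => /=.
  by rewrite (rank_bij beta_bij row_inj ss) row_rank.
split.
  apply: (@eq_bij _ _ (urankV \o row)) => [|x]; last by rewrite ffunE.
  by apply: bij_comp row_bij; exists urank.
apply/ssE => x y xy.
have rankE z : rank (letter u) (beta0 z) = row_of z.
  by rewrite [beta0 z]ffunE; move/(congr1 val): (urankVK (row z)).
by rewrite -(rank_lt (letter u)) !rankE.
Qed.

(** * Shapes with two cells in a row, and the conclusion *)

Lemma not_all1_row_pair la : all (leq 1) la ->
  ~~ all (pred1 1%N) la ->
  exists x y : cell la, row_of x = row_of y /\ (col_of x < col_of y)%N.
Proof.
move=> la_pos /allPn[a /(nthP 0%N)[r r_lt <-] /= a_neq1].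
have a_gt1 : (1 < nth 0%N la r)%N.
  by rewrite ltn_neqAle eq_sym a_neq1 (all_nthP 0%N la_pos).
pose row := Ordinal r_lt; pose I := fun r : 'I_(size la) => 'I_(nth 0%N la r).
exists (@existT _ I row (Ordinal (ltnW a_gt1))), (@existT _ I row (Ordinal a_gt1)).
by [].
Qed.

Theorem proposition5p3 :
  (forall (n : nat) (la : seq nat) (c : rat) (m : nat) (G : lgraph m),
     (1 <= n)%N -> is_partition n la -> c *: S_ la = Y G ->
     la = nseq n 1%N /\ c = 1) /\
  (forall n : nat, (1 <= n)%N -> S_ (nseq n 1%N) = Y (complete_graph n)).
Proof.
split=> [n la c m G _ /and3P[_ la_pos /eqP la_n] cSY|n _]; last first.
  by rewrite S_column_eq_Y_complete ?all_nseq /= ?orbT // sumn_nseq mul1n.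
have cSYu u : c * S_ la u = Y G u by rewrite -cSY.
(* Otherwise the word of [m] distinct letters has coefficient 0 on the left and 1 on the right. *)
have mE : sumn la = m.
  apply/eqP/negPn/negP => mn.
  have := cSYu (iota 0 m); rewrite S_coef_size ?size_iota 1?eq_sym // mulr0 Y_iota.
  by move/eqP; rewrite eq_sym oner_eq0.
case: m / mE G cSY cSYu => G cSY cSYu.
have cN u : size u = sumn la ->
    c * #|labellings la u|%:R = `[< proper_colouring G (letter u) >]%:R.
  by move=> su; rewrite -S_coef // cSYu Y_coef su eqxx.
have N_iota : c * #|labellings la (iota 0 (sumn la))|%:R = 1.
  by rewrite -S_coef ?size_iota // cSYu Y_iota.
have c_neq0 : c != 0.
  by apply: contra_eq_neq N_iota => ->; rewrite mul0r eq_sym oner_eq0.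
have [la1|] := boolP (all (pred1 1%N) la).
  have laE := all_pred1P _ _ la1.
  split; first by rewrite [LHS]laE -la_n [in RHS]laE sumn_nseq mul1n.
  by have := cSYu (iota 0 (sumn la)); rewrite S_column_eq_Y_complete // !Y_iota mulr1.
case/not_all1_row_pair=> // x [y [row_xy col_xy]].
have xy : x != y by apply: contraTneq col_xy => ->; rewrite ltnn.
have cell_ord : #|{: cell la}| = #|'I_(sumn la)| by rewrite card_cell card_ord.
have no_edge i j : G i j = false.
  apply/negP => Gij; have ij : i != j.
    by apply: contraTneq Gij => ->; rewrite (adj_irrefl G).
  have [beta [beta_bij bx by_]] := exists_bij2 cell_ord xy ij.
  have [u su [beta_u row_u]] := exists_row_word beta_bij.
  have := cN u su; case: asboolP => [/(_ i j Gij)|_ /eqP].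
    by rewrite -bx -by_ !row_u row_xy.
  rewrite mulf_eq0 (negPf c_neq0) pnatr_eq0 cards_eq0 /= => /eqP u0.
  by rewrite u0 inE in beta_u.
have cards_eq : #|labellings la (nseq (sumn la) 0%N)| =
    #|labellings la (iota 0 (sumn la))|.
  apply/eqP; rewrite -(eqr_nat rat) -(inj_eq (mulfI c_neq0)) N_iota.
  rewrite cN ?size_nseq //; case: asboolP => // -[] i j.
  by rewrite no_edge.
have letter0 (i : 'I_(sumn la)) : letter (nseq (sumn la) 0%N) i = 0%N.
  by rewrite ffunE nth_nseq if_same.
have /card_gt0P[b0 /labellingsP[_ ss0]] :
    (0 < #|labellings la (nseq (sumn la) 0%N)|)%N.
  rewrite cards_eq lt0n; apply: contra_eq_neq N_iota => ->.
  by rewrite mulr0 eq_sym oner_eq0.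
have ss0E (beta : {ffun cell la -> 'I_(sumn la)}) :
    bijective beta -> beta \in labellings la (nseq (sumn la) 0%N).
  move=> beta_bij; apply/labellingsP; split=> //.
  suff -> : [ffun x => letter (nseq (sumn la) 0%N) (beta x)] =
    [ffun x => letter (nseq (sumn la) 0%N) (b0 x)] by [].
  by apply/ffunP => z; rewrite [LHS]ffunE [RHS]ffunE !letter0.
have sub : labellings la (iota 0 (sumn la)) \subset labellings la (nseq (sumn la) 0%N).
  by apply/fintype.subsetP => b /labellingsP[/ss0E].
have [b b_bij] := exists_bij cell_ord.
have bxy : b y != b x by rewrite (inj_eq (bij_inj b_bij)) eq_sym.
(* An inclusion of finite sets of equal size: every bijection is also admissible for the word with
   distinct letters. *)
have iotaE : labellings la (iota 0 (sumn la)) = labellings la (nseq (sumn la) 0%N).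
  by apply/eqP; rewrite eqEcard sub cards_eq leqnn.
have increasing (beta : {ffun cell la -> 'I_(sumn la)}) :
    bijective beta -> (beta x <= beta y)%N.
  move=> /ss0E; rewrite -iotaE => /labellingsP[_ [rows _]].
  by have := rows x y row_xy (ltnW col_xy); rewrite !ffunE !nth_iota.
(* [b'] takes the values of [b] at [x] and [y] in exchanged order, so [increasing] yields both
   inequalities between two distinct positions. *)
have [b' [b'_bij b'x b'y]] := exists_bij2 cell_ord xy bxy.
have := increasing _ b'_bij; rewrite b'x b'y => yx.
by case/negP: bxy; rewrite -val_eqE eqn_leq yx increasing.
Qed.
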